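(* Let $\mathcal{A}\subset B(\mathfrak{H})$ be a finite-dimensional operator algebra, let $d\in\mathbb{N}$ and let $A\in\mathbb{M}_d(\mathcal{A})$. Then there is a finite-dimensional Hilbert space $\mathfrak{F}$ and a completely contractive homomorphism $\pi:\mathcal{A}\to B(\mathfrak{F})$ with the property that $\|\pi^{(d)}(A)\|=\|A\|$.
   Context: An operator algebra is a norm closed subalgebra of $B(\mathfrak{H})$, $\mathfrak{H}$ a complex Hilbert space (not necessarily unital or self-adjoint). $\mathbb{M}_d(\mathcal{A})$ has the norm inherited from $B(\mathfrak{H}^{(d)})$, $\mathfrak{H}^{(d)}$ being the direct sum of $d$ copies of $\mathfrak{H}$; $\pi^{(d)}$ denotes the entrywise ampliation of $\pi$, and $\pi$ is completely contractive if $\pi^{(n)}$ is contractive for every $n$. *)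

(* Defs.v *)
From HB Require Import structures.
From mathcomp Require Import all_boot all_order all_algebra.
From mathcomp Require Import complex.
From mathcomp Require Import boolp classical_sets functions reals topology normedtype.
Set Implicit Arguments.
Unset Strict Implicit.
Unset Printing Implicit Defensive.
Import Order.TTheory GRing.Theory Num.Theory.
Import numFieldNormedType.Exports.
Local Open Scope classical_set_scope.
Local Open Scope ring_scope.

HB.mixin Record NormedModule_isHilbert (R : realType) H
    & CompleteNormedModule R[i] H := {
  inner : {dot H for @Num.conj R[i]} ;
  normr_inner : forall x : H, `|x| ^+ 2 = inner x x
}.

#[short(type="hilbertType")]
HB.structure Definition Hilbert (R : realType) :=
  {H of CompleteNormedModule R[i] H & NormedModule_isHilbert R H}.

(* The Hilbert space direct sum of d copies of H, with the l2 norm. *)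
Definition hsum (d : nat) (H : Type) : Type := {ffun 'I_d -> H}.

Section hsum_normed.
Variables (C : numClosedFieldType) (d : nat) (H : normedModType C).

HB.instance Definition _ := GRing.Lmodule.copy (hsum d H) {ffun 'I_d -> H}.

Definition hsum_norm (x : hsum d H) : C := sqrtC (\sum_i `|x i| ^+ 2).

Let sum_ge0 (x : hsum d H) : 0 <= \sum_i `|x i| ^+ 2.
Proof. by apply: sumr_ge0 => i _; rewrite exprn_ge0. Qed.

Let rnorm (x : hsum d H) : 'rV[C]_d := \row_i `|x i|.

Let dotmx_ge0 (u : 'rV[C]_d) : (forall i, 0 <= u 0 i) ->
  dotmx u u = \sum_i u 0 i ^+ 2.
Proof.
move=> u0; rewrite dotmxE mxE; apply: eq_bigr => i _.
by rewrite !mxE expr2 (CrealP (ger0_real (u0 i))).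
Qed.

Lemma ler_hsum_normD x y : hsum_norm (x + y) <= hsum_norm x + hsum_norm y.
Proof.
have E (z : hsum d H) : hsum_norm z = sqrtC (dotmx (rnorm z) (rnorm z)).
  rewrite dotmx_ge0 => [|i]; last by rewrite mxE.
  by congr sqrtC; apply: eq_bigr => i _; rewrite mxE.
rewrite (E x) (E y).
set u := rnorm x + rnorm y.
apply: (@le_trans _ _ (sqrtC (dotmx u u))); last first.
  by case: (triangle_lerif (@dotmx C d) (rnorm x) (rnorm y)).
rewrite dotmx_ge0 => [|i]; last by rewrite !mxE addr_ge0.
rewrite /hsum_norm ler_sqrtC ?nnegrE//; last first.
  by apply: sumr_ge0 => i _; rewrite !mxE exprn_ge0// addr_ge0.
apply: ler_sum => i _; rewrite !mxE lerXn2r ?nnegrE ?addr_ge0//.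
by rewrite ffunE ler_normD.
Qed.

Lemma hsum_normZ (a : C) x : hsum_norm (a *: x) = `|a| * hsum_norm x.
Proof.
rewrite /hsum_norm -[in RHS](sqrCK (normr_ge0 a)) -sqrtCM ?nnegrE ?exprn_ge0//.
congr sqrtC; rewrite mulr_sumr; apply: eq_bigr => i _.
by rewrite ffunE normrZ exprMn.
Qed.

Lemma hsum_norm_eq0 x : hsum_norm x = 0 -> x = 0.
Proof.
move/eqP; rewrite sqrtC_eq0 psumr_eq0 => [/allP x0|i _]; last exact: exprn_ge0.
apply/ffunP => i; rewrite ffunE; apply/eqP.
by have := x0 i (mem_index_enum i); rewrite sqrf_eq0 normr_eq0.
Qed.

HB.instance Definition _ := Lmodule_isNormed.Build C (hsum d H)
  ler_hsum_normD hsum_normZ hsum_norm_eq0.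

Lemma hsum_normE (x : hsum d H) : `|x| = sqrtC (\sum_i `|x i| ^+ 2).
Proof. by []. Qed.

Lemma ler_hsum_coord (x : hsum d H) i : `|x i| <= `|x|.
Proof.
rewrite -[leLHS](sqrCK (normr_ge0 _)) hsum_normE ler_sqrtC ?nnegrE ?exprn_ge0//.
by rewrite (bigD1 i)//= lerDl sumr_ge0// => j _; rewrite exprn_ge0.
Qed.

Lemma ler_hsum_norm (x : hsum d H) : `|x| <= \sum_i `|x i|.
Proof.
rewrite hsum_normE -[leRHS]sqrCK ?sumr_ge0// ler_sqrtC ?nnegrE ?exprn_ge0 ?sumr_ge0//.
rewrite expr2 mulr_suml; apply: ler_sum => i _.
  by rewrite expr2 ler_wpM2l// (bigD1 i)//= lerDl sumr_ge0.
by move=> i _; rewrite exprn_ge0.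
Qed.

End hsum_normed.

Section hsum_complete.
Variables (C : numClosedFieldType) (d : nat) (H : completeNormedModType C).

Lemma hsum_complete (F : set_system (hsum d H)) :
  ProperFilter F -> cauchy F -> cvg F.
Proof.
move=> FF /cauchy_ballP Fc.
have cvi i : cvg ((fun x : hsum d H => x i) @ F).
  apply: cauchy_cvg; apply/cauchy_ballP => e e0.
  rewrite near_map2; apply: filterS (Fc e e0) => -[x y]/=.
  rewrite -!ball_normE/= => /(le_lt_trans _); apply.
  by have := ler_hsum_coord (x - y) i; rewrite !ffunE.
pose l : hsum d H := [ffun i => lim ((fun x : hsum d H => x i) @ F)].
apply/cvg_ex; exists l; apply/cvgrPdist_le => e e0.
have e'0 : 0 < e / d.+1%:R by rewrite divr_gt0.
have : F [set x | forall i, `|l i - x i| <= e / d.+1%:R].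
  apply: filter_forall => i; rewrite ffunE.
  by move/cvgrPdist_le : (cvi i); apply.
apply: filterS => x lx; apply: le_trans (ler_hsum_norm _) _.
apply: le_trans (_ : \sum_(i < d) e / d.+1%:R <= _).
  by apply: ler_sum => i _; have := lx i; rewrite !ffunE.
rewrite sumr_const card_ord -[leLHS]mulr_natr -mulrA ler_piMr ?(ltW e0)//.
by rewrite mulrC ler_pdivrMr// mul1r ler_nat.
Qed.

HB.instance Definition _ := Uniform_isComplete.Build (hsum d H) hsum_complete.

End hsum_complete.

Section hsum_hilbert.
Variables (R : realType) (d : nat) (H : hilbertType R).

Definition hsum_inner (x y : hsum d H) : R[i] := \sum_i inner (x i) (y i).

Let hsum_inner_bilinear : bilinear_for
  ( *%R : GRing.Scale.law R[i] R[i]) (@Num.conj R[i] \; *%R) hsum_inner.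
Proof.
split=> [y a x x'|y a x x'] /=; rewrite /hsum_inner mulr_sumr -big_split/=;
  apply: eq_bigr => i _; rewrite !ffunE.
- by rewrite linearDl linearZl_LR.
- by rewrite linearDr linearZr_LR.
Qed.

HB.instance Definition _ := bilinear_isBilinear.Build R[i] (hsum d H) (hsum d H)
  R[i] *%R (@Num.conj R[i] \; *%R) hsum_inner hsum_inner_bilinear.

Let hsum_innerC x y :
  hsum_inner x y = (-1) ^+ false * Num.conj (hsum_inner y x).
Proof.
rewrite expr0 mul1r rmorph_sum; apply: eq_bigr => i _.
by rewrite hermC expr0 mul1r.
Qed.

HB.instance Definition _ := isHermitianSesquilinear.Build R[i] (hsum d H)
  false (@Num.conj R[i]) hsum_inner hsum_innerC.

Let hsum_inner_norm (x : hsum d H) : `|x| ^+ 2 = hsum_inner x x.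
Proof.
by rewrite hsum_normE sqrtCK; apply: eq_bigr => i _; rewrite normr_inner.
Qed.

Let hsum_inner_gt0 (x : hsum d H) : x != 0 -> 0 < hsum_inner x x.
Proof. by move=> x0; rewrite -hsum_inner_norm exprn_gt0// normr_gt0. Qed.

HB.instance Definition _ :=
  isDotProduct.Build R[i] (hsum d H) hsum_inner hsum_inner_gt0.

HB.instance Definition _ := NormedModule_isHilbert.Build R (hsum d H)
  hsum_inner_norm.

End hsum_hilbert.

Definition bounded_op (K : numFieldType) (V W : normedModType K)
    (T : V -> W) : Prop :=
  linear T /\ exists M : K, forall x, `|T x| <= M * `|x|.

(* The norm of a normed module over R[i] takes values in R[i]. *)
Definition opnorm (R : realType) (V W : normedModType R[i]) (T : V -> W) : R :=
  sup [set complex.Re `|T x| | x in [set x | `|x| <= 1]].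

Definition finite_dim (K : pzRingType) (V : lmodType K) (A : set V) : Prop :=
  exists (n : nat) (b : 'I_n -> V),
    A = [set \sum_i c i *: b i | c in [set: 'I_n -> K]].

Section operator_algebras.
Variable R : realType.

Record operator_algebra (H : hilbertType R) (A : set (H -> H)) : Prop := {
  opalg_bounded : A `<=` @bounded_op _ H H ;
  opalg0 : A 0 ;
  opalg_linear : forall (a : R[i]) S T, A S -> A T -> A (a *: S + T) ;
  opalg_comp : forall S T, A S -> A T -> A (S \o T) ;
  opalg_closed : forall T, bounded_op T ->
    (forall e : R, 0 < e -> exists2 S, A S & opnorm (T - S) < e) -> A T
}.

(* The operator on the direct sum of d copies of H given by a d x d matrix of
   operators on H. *)
Definition mxop (d : nat) (H : hilbertType R) (X : 'M[H -> H]_d) :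
    hsum d H -> hsum d H :=
  fun x => [ffun i => \sum_j X i j (x j)].

Definition mx_over (d : nat) (H : hilbertType R) (A : set (H -> H))
    (X : 'M[H -> H]_d) : Prop :=
  forall i j, A (X i j).

(* The values of pi outside A are irrelevant. *)
Record opalg_hom (H F : hilbertType R) (A : set (H -> H))
    (pi : (H -> H) -> (F -> F)) : Prop := {
  hom_bounded : forall T, A T -> bounded_op (pi T) ;
  hom_linear : forall (a : R[i]) S T, A S -> A T ->
    pi (a *: S + T) = a *: pi S + pi T ;
  hom_comp : forall S T, A S -> A T -> pi (S \o T) = pi S \o pi T
}.

Definition completely_contractive (H F : hilbertType R) (A : set (H -> H))
    (pi : (H -> H) -> (F -> F)) : Prop :=
  forall (n : nat) (X : 'M[H -> H]_n), mx_over A X ->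
    opnorm (mxop (map_mx pi X)) <= opnorm (mxop X).

End operator_algebras.

(* Main.v *)
From HB Require Import structures.
Require Import Defs.
From mathcomp Require Import all_boot all_order all_algebra.
From mathcomp Require Import complex.
From mathcomp Require Import boolp classical_sets functions reals.
From mathcomp Require Import interval_inference topology normedtype.
Set Implicit Arguments.
Unset Strict Implicit.
Unset Printing Implicit Defensive.
Import Order.TTheory GRing.Theory Num.Theory.
Import numFieldNormedType.Exports.
Local Open Scope classical_set_scope.
Local Open Scope ring_scope.
Local Open Scope complex_scope.

(* Choose xi_s in the unit ball of H^(d) on which X almost attains its norm. The
   coordinates of xi_s and their images under a basis of A span an A-invariant
   subspace of H whose dimension is bounded independently of s. In orthonormal
   bases of these subspaces, the restrictions of A become completely
   contractive representations by matrices of one fixed size. Their entrywise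
   limit along an ultrafilter is again a completely contractive homomorphism,
   and it attains the norm of X at the limit of the coordinate vectors of the
   xi_s. *)


(** * Complex limits along filters and ultrafilters *)

Section complex_limits.
Variable R : realType.
Implicit Types z : R[i].

Lemma normc_ge_Im z : (`|complex.Im z|)%:C <= `|z|.
Proof.
rewrite normc_def lecR -sqrtr_sqr ler_wsqrtr// lerDr sqr_ge0 //.
Qed.

Lemma normc_le_ReIm z : `|z| <= (`|complex.Re z| + `|complex.Im z|)%:C.
Proof.
rewrite normc_def lecR -(ger0_norm (addr_ge0 (normr_ge0 _) (normr_ge0 _))).
rewrite -sqrtr_sqr ler_wsqrtr// sqrrD !real_normK ?num_real//.
by rewrite addrAC lerDl mulrn_wge0 ?mulr_ge0.
Qed.

Lemma cvg_complex T (F : set_system T) (FF : Filter F) (z : T -> R[i]^o) (l : R[i]^o) :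
  complex.Re (z x) @[x --> F] --> complex.Re l ->
  complex.Im (z x) @[x --> F] --> complex.Im l -> z @ F --> l.
Proof.
move=> /cvgrPdist_le cr /cvgrPdist_le ci; apply/cvgrPdist_le => e e0.
(* In the order of [R[i]] a positive element has imaginary part zero. *)
have [r r0 re] : exists2 r : R, 0 < r & e = r%:C.
  by exists (complex.Re e); case: e e0 => a b /=; rewrite ltcE/= => /andP[/eqP b0 //]; rewrite ?b0.
have h : 0 < r / 2 by rewrite divr_gt0.
near=> x; apply: le_trans (normc_le_ReIm _) _.
rewrite re lecR !raddfB [r]splitr lerD//; near: x; [exact: cr|exact: ci].
Unshelve. all: by end_near. Qed.

Lemma complex_complete (F : set_system R[i]^o) :
  ProperFilter F -> cauchy F -> cvg F.
Proof.
move=> FF /cauchy_ballP Fc.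
have cvp (p : R[i] -> R) : (forall x y, `|p x - p y|%:C <= `|x - y|) -> cvg (p @ F).
  move=> pl; apply: cauchy_cvg; apply/cauchy_ballP => e e0.
  rewrite near_map2; apply: filterS (Fc e%:C _) => [|]; last by rewrite ltcR.
  move=> -[x y]/=; rewrite -!ball_normE/= -ltcR; exact: le_lt_trans.
have cr : cvg (@complex.Re R @ F).
  by apply: cvp => x y; rewrite -raddfB normc_ge_Re.
have ci : cvg (@complex.Im R @ F).
  by apply: cvp => x y; rewrite -raddfB normc_ge_Im.
apply/cvg_ex; exists (lim (@complex.Re R @ F) +i* lim (@complex.Im R @ F)).
exact: (@cvg_complex _ F _ id).
Qed.

(** Real and imaginary parts stay in the compact segment from [-M] to [M], where every ultrafilter
    converges. *)
Lemma ultra_bounded_cvg T (U : set_system T) (UU : UltraFilter U) (z : T -> R[i]^o) (M : R) :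
  (forall t, `|z t| <= M%:C) -> cvg (z @ U).
Proof.
move=> zM.
have cvp (p : R[i] -> R) : (forall x, `|p x|%:C <= `|x|) -> cvg (p (z x) @[x --> U]).
  move=> pl.
  have : compact `[-M, M] by exact: segment_compact.
  (* Maximality of the image: if the preimage of [B] is not in [U], that of its complement is, so a
     larger proper filter cannot contain [B]. *)
  have UP : UltraFilter (p \o z @ U).
    split; first exact: fmap_proper_filter.
    move=> G GP sG; apply/seteqP; split => // B GB.
    have [//|nB] := in_ultra_setVsetC ((p \o z) @^-1` B) UU.
    have /sG GnB : (p \o z @ U) (~` B) by [].
    by case: (filter_not_empty G); rewrite -(setICr B); apply: filterI.
  rewrite compact_ultra => /(_ _ UP)[|l [_ ?]]; last by apply/cvg_ex; exists l.
  apply: (@filterE _ U) => t /=; rewrite in_itv/= -ler_norml -lecR.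
  exact: le_trans (pl _) (zM t).
have cr := cvp _ (@normc_ge_Re R).
have ci := cvp _ normc_ge_Im.
apply/cvg_ex; exists (lim (complex.Re (z x) @[x --> U]) +i* lim (complex.Im (z x) @[x --> U])).
exact: cvg_complex.
Qed.

End complex_limits.

(** * The complex line as a Hilbert space *)

(* The regular module [R[i]^o] does not accept a completeness instance
   (its canonical one is the instance of [R^o] for real [R]), hence the separate
   name. *)
Definition complex_line (R : realType) : Type := R[i].

HB.instance Definition _ (R : realType) := NormedModule.copy (complex_line R) R[i]^o.

HB.instance Definition _ (R : realType) :=
  Uniform_isComplete.Build (complex_line R) (@complex_complete R).

Section complex_hilbert.
Variable R : realType.

Definition complex_inner (x y : (complex_line R)) : R[i] := x * Num.conj y.

Let complex_inner_bilinear : bilinear_for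
  ( *%R : GRing.Scale.law R[i] R[i]) (@Num.conj R[i] \; *%R) complex_inner.
Proof.
split=> [y a x x'|y a x x'] /=; rewrite /complex_inner.
- by rewrite mulrDl -mulrA.
- by rewrite rmorphD rmorphM mulrDr mulrCA.
Qed.

HB.instance Definition _ := bilinear_isBilinear.Build R[i] (complex_line R) (complex_line R)
  R[i] *%R (@Num.conj R[i] \; *%R) complex_inner complex_inner_bilinear.

Let complex_innerC x y :
  complex_inner x y = (-1) ^+ false * Num.conj (complex_inner y x).
Proof. by rewrite expr0 mul1r rmorphM/= conjCK mulrC. Qed.

HB.instance Definition _ := isHermitianSesquilinear.Build R[i] (complex_line R)
  false (@Num.conj R[i]) complex_inner complex_innerC.

Let complex_inner_norm (x : (complex_line R)) : `|x| ^+ 2 = complex_inner x x.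
Proof. exact: normCK. Qed.

Let complex_inner_gt0 (x : (complex_line R)) : x != 0 -> 0 < complex_inner x x.
Proof. by move=> x0; rewrite -complex_inner_norm exprn_gt0// normr_gt0. Qed.

HB.instance Definition _ :=
  isDotProduct.Build R[i] (complex_line R) complex_inner complex_inner_gt0.

HB.instance Definition _ := NormedModule_isHilbert.Build R (complex_line R)
  complex_inner_norm.

End complex_hilbert.



(** * Linear maps and the operator norm *)

Section linear_maps.
Variables (K : numFieldType) (V W : normedModType K) (T : V -> W).
Hypothesis lT : linear T.

Lemma linear_prop0 : T 0 = 0.
Proof. by have := lT (-1) 0 0; rewrite scaler0 addr0 scaleN1r addNr. Qed.

Lemma linear_propZ a x : T (a *: x) = a *: T x.
Proof. by have := lT a x 0; rewrite linear_prop0 !addr0. Qed.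

Lemma linear_prop_sum (I : finType) (x : I -> V) :
  T (\sum_i x i) = \sum_i T (x i).
Proof.
apply: (big_morph T _ linear_prop0) => y z.
by have := lT 1 y z; rewrite !scale1r.
Qed.

End linear_maps.

Section operator_norm.
Variables (R : realType) (V W : normedModType R[i]).
Implicit Types T : V -> W.

Lemma real_complex_of_ge0 (e : R[i]) : 0 <= e -> e = (complex.Re e)%:C.
Proof. by case: e => a b; rewrite lecE/= => /andP[/eqP-> _]. Qed.

Lemma opnorm_le T (M : R) :
  (forall x, `|x| <= 1 -> `|T x| <= M%:C) -> opnorm T <= M.
Proof.
move=> TM; apply: ge_sup.
  by exists (complex.Re `|T 0|), 0 => //=; rewrite normr0.
by move=> _ [x /= /TM + <-]; rewrite lecE => /andP[].
Qed.

Lemma opnorm_has_sup T : bounded_op T ->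
  has_sup [set complex.Re `|T x| | x in [set x | `|x| <= 1]].
Proof.
move=> [_ [M TM]]; split.
  by exists (complex.Re `|T 0|), 0 => //=; rewrite normr0.
(* On a zero space [M] may be any complex number, hence the absolute value. *)
exists (complex.Re `|M|) => _ [x /= x1 <-].
suff : `|T x| <= `|M| by rewrite lecE => /andP[].
apply: le_trans (TM x) _; apply: le_trans (_ : `|M * `|x| | <= _).
  by rewrite ger0_norm// (le_trans _ (TM x)).
by rewrite normrM normr_id ler_piMr.
Qed.

Lemma opnorm_ub T x : bounded_op T -> `|x| <= 1 -> `|T x| <= (opnorm T)%:C.
Proof.
move=> bT x1; rewrite (real_complex_of_ge0 (normr_ge0 (T x))) lecR.
by apply: sup_upper_bound; [exact: opnorm_has_sup|exists x].
Qed.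

Lemma opnorm_ge0 T : bounded_op T -> 0 <= opnorm T.
Proof.
move=> bT; rewrite -ler0c; apply: le_trans (opnorm_ub (x := 0) bT _) => //.
by rewrite normr0.
Qed.

Lemma ler_opnorm T x : bounded_op T -> `|T x| <= (opnorm T)%:C * `|x|.
Proof.
move=> bT; have [->|x0] := eqVneq x 0.
  by rewrite (linear_prop0 bT.1) !normr0 mulr0.
have n0 : 0 < `|x| by rewrite normr_gt0.
rewrite -ler_pdivrMr// mulrC -[X in X * _](ger0_norm (x := `|x|^-1)) ?invr_ge0//.
rewrite -normrZ -(linear_propZ bT.1); apply: opnorm_ub => //.
by rewrite normrZ ger0_norm ?invr_ge0// mulVf// gt_eqF.
Qed.

Lemma opnorm_approx T (e : R) : bounded_op T -> 0 < e ->
  exists2 x, `|x| <= 1 & (opnorm T - e)%:C <= `|T x|.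
Proof.
move=> bT e0; have [_ [x /= x1 <-] xe] := sup_adherent e0 (opnorm_has_sup bT).
by exists x => //; rewrite (real_complex_of_ge0 (normr_ge0 (T x))) lecR ltW.
Qed.

End operator_norm.

(** * Limits of norms and convergence in finite direct sums *)

Section cvg_norm.
Variables (C : numClosedFieldType).

Lemma cvg_norm_le (V : normedModType C) T (F : set_system T) (FF : ProperFilter F)
    (f : T -> V) (l : V) (M : C) :
  f @ F --> l -> (forall t, `|f t| <= M) -> `|l| <= M.
Proof.
move=> /cvgrPdist_le fl fM; apply/ler_addgt0Pr => e e0.
have [t lt] := filter_ex (fl e e0).
by rewrite -(subrK (f t) l) addrC (le_trans (ler_normD _ _))// lerD.
Qed.

(** The bound is assumed only eventually and up to [e], because it will be applied to vectors that
    attain a norm only approximately. *)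
Lemma cvg_norm_ge (V : normedModType C) T (F : set_system T) (FF : ProperFilter F)
    (f : T -> V) (l : V) (M : C) :
  f @ F --> l -> (forall e, 0 < e -> \forall t \near F, M - e <= `|f t|) ->
  M <= `|l|.
Proof.
move=> /cvgrPdist_le fl fM; apply/ler_addgt0Pr => e e0.
have e20 : 0 < e / 2 by rewrite divr_gt0.
have [t [lt Mt]] := filter_ex (filterI (fl _ e20) (fM _ e20)).
rewrite [e]splitr addrA -lerBlDr (le_trans Mt)// -lerBlDl.
by rewrite (le_trans _ lt)// distrC lerB_dist.
Qed.

Lemma cvg_sum_ord (V : normedModType C) T (F : set_system T) (FF : ProperFilter F)
    n (f : 'I_n -> T -> V) (l : 'I_n -> V) :
  (forall i, f i @ F --> l i) -> \sum_i f i x @[x --> F] --> \sum_i l i.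
Proof.
elim: n f l => [|n IH] f l fl.
  rewrite big_ord0; under eq_fun do rewrite big_ord0; exact: cvg_cst.
rewrite big_ord_recr/=; under eq_fun do rewrite big_ord_recr/=.
by apply: cvgD => //; apply: IH => i; apply: fl.
Qed.

Lemma cvg_hsum (H : normedModType C) T (F : set_system T) (FF : ProperFilter F)
    n (f : T -> hsum n H) (l : hsum n H) :
  (forall i, f x i @[x --> F] --> l i) -> f @ F --> l.
Proof.
move=> fl; apply/cvgrPdist_le => e e0.
(* [n.+1] keeps the denominator nonzero for [n = 0]; the [n] coordinates still add up to at most
   [e]. *)
have e'0 : 0 < e / n.+1%:R by rewrite divr_gt0.
have : F [set x | forall i, `|l i - f x i| <= e / n.+1%:R].
  by apply: filter_forall => i; move/cvgrPdist_le : (fl i); apply.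
apply: filterS => x lx; apply: le_trans (ler_hsum_norm _) _.
apply: le_trans (_ : \sum_(i < n) e / n.+1%:R <= _).
  by apply: ler_sum => i _; have := lx i; rewrite !ffunE.
rewrite sumr_const card_ord -[leLHS]mulr_natr -mulrA ler_piMr ?(ltW e0)//.
by rewrite mulrC ler_pdivrMr// mul1r ler_nat.
Qed.

Lemma ler_hsum (V W : normedModType C) n (x : hsum n V) (y : hsum n W) :
  (forall i, `|x i| <= `|y i|) -> `|x| <= `|y|.
Proof.
have s0 (Z : normedModType C) (z : hsum n Z) : 0 <= \sum_i `|z i| ^+ 2.
  by apply: sumr_ge0 => i _; exact: exprn_ge0.
move=> xy; rewrite !hsum_normE ler_sqrtC ?nnegrE//.
by apply: ler_sum => i _; rewrite lerXn2r ?nnegrE.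
Qed.

End cvg_norm.

Lemma bounded_mxop (R : realType) (H : hilbertType R) m (X : 'M[H -> H]_m) :
  (forall i j, bounded_op (X i j)) -> bounded_op (mxop X).
Proof.
move=> bX; split.
  move=> a x y; apply/ffunP => i; rewrite !ffunE scaler_sumr -big_split/=.
  by apply: eq_bigr => j _; rewrite !ffunE (bX i j).1.
exists (\sum_i \sum_j (opnorm (X i j))%:C) => x.
apply: le_trans (ler_hsum_norm _) _; rewrite mulr_suml ler_sum// => i _.
rewrite ffunE (le_trans (ler_norm_sum _ _ _))// mulr_suml ler_sum// => j _.
apply: le_trans (ler_opnorm _ (bX i j)) _.
by rewrite ler_wpM2l ?ler_hsum_coord// ler0c opnorm_ge0.
Qed.

(** * Orthonormalisation and coordinates *)

Section gram_schmidt.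
Variables (R : realType) (H : hilbertType R).

Lemma innerC (x y : H) : inner x y = Num.conj (inner y x).
Proof. by rewrite hermC expr0 mul1r. Qed.

(* Zero vectors are allowed, so that the number of vectors can be prescribed. *)
Definition orthonormal0 n (e : 'I_n -> H) :=
  forall i j, inner (e i) (e j) = ((i == j) && (e i != 0))%:R.

Definition coefs n (e : 'I_n -> H) (h : H) : hsum n (complex_line R) :=
  [ffun i => inner h (e i)].

(** For [e] with [orthonormal0], [synth e (coefs e h)] is the orthogonal projection of [h] onto the
    span of [e]; the equation [h = synth e (coefs e h)] thus encodes membership in the span. *)
Definition synth n (e : 'I_n -> H) (x : hsum n (complex_line R)) : H :=
  \sum_i (x i : R[i]) *: e i.

(** Induction on [n]: the residue [r] of [v n] after projection is normalised and becomes the next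
    vector. The last clause is span induction: a property stable under linear combinations passes
    from the [v k] to the [e k]. *)
Lemma gram_schmidt_nat (v : nat -> H) n : exists e : nat -> H,
  [/\ forall i j, (i < n)%N -> (j < n)%N ->
        inner (e i) (e j) = ((i == j) && (e i != 0))%:R,
      forall k, (k < n)%N -> v k = \sum_(i < n) inner (v k) (e i) *: e i
    & forall P : H -> Prop, P 0 ->
        (forall a x y, P x -> P y -> P (a *: x + y)) ->
        (forall k, (k < n)%N -> P (v k)) -> forall k, (k < n)%N -> P (e k)].
Proof.
elim: n => [|n [e [eO ev eP]]]; first by exists (fun=> 0); split.
pose r := v n - \sum_(i < n) inner (v n) (e i) *: e i.
have re i : (i < n)%N -> inner r (e i) = 0.
  move=> ni; rewrite linearBl linear_sumlz.
  rewrite (bigD1 (Ordinal ni))//= big1 ?addr0 => [|j ji]; last first.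
    rewrite linearZl_LR/= eO// -val_eqE/= in ji *.
    by rewrite (negbTE ji) mulr0.
  rewrite linearZl_LR/= eO// eqxx/=.
  have [->|_] := eqVneq (e i) 0; first by rewrite linear0r mul0r subr0.
  by rewrite mulr1 subrr.
(* If [r = 0] then [w = 0]: dependent vectors contribute zero vectors. *)
pose w := `|r|^-1 *: r.
have ww : inner w w = (w != 0)%:R.
  rewrite -normr_inner /w; have [->|r0] := eqVneq r 0.
    by rewrite scaler0 eqxx normr0 expr0n.
  have n0 : `|r| != 0 by rewrite normr_eq0.
  by rewrite normrZ normfV normr_id mulVf// expr1n scaler_eq0 invr_eq0 negb_or n0 r0.
have we i : (i < n)%N -> inner w (e i) = 0.
  by move=> ni; rewrite linearZl_LR/= re// mulr0.
(* The earlier [v k] lie in the span of the earlier [e i], so their expansions gain no term. *)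
have vw k : (k < n)%N -> inner (v k) w = 0.
  move=> kn; rewrite (ev k kn) linear_sumlz big1// => i _.
  by rewrite linearZl_LR/= (innerC (e i)) we// conjC0 mulr0.
(* Here [inner (v n) w = inner r w], which is the norm of [r], so the new term is exactly [r]. *)
have vn : v n = \sum_(i < n) inner (v n) (e i) *: e i + inner (v n) w *: w.
  have -> : inner (v n) w = inner r w.
    rewrite /r linearBl linear_sumlz big1 ?subr0// => i _.
    by rewrite linearZl_LR/= (innerC (e i)) we// conjC0 mulr0.
  rewrite /w; have [r0|r0] := eqVneq r 0.
    have -> : `|r|^-1 *: r = 0 by rewrite r0 scaler0.
    by rewrite scaler0 addr0; apply/eqP; rewrite -subr_eq0 -/r r0.
  have n0 : `|r| != 0 by rewrite normr_eq0.
  rewrite linearZr_LR/= -normr_inner scalerA conj_Creal ?realV ?normr_real//.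
  by rewrite expr2 mulrA mulVf// mul1r mulfV// scale1r /r addrC subrK.
exists (fun k => if k == n then w else e k); split.
- move=> i j; rewrite !ltnS => iln jln.
  have [ni|ni] := eqVneq i n; have [nj|nj] := eqVneq j n => /=.
  + by rewrite ww ni nj eqxx.
  + by rewrite we 1?ltn_neqAle ?nj// ni eq_sym (negbTE nj).
  + by rewrite innerC we 1?ltn_neqAle ?ni// nj (negbTE ni) conjC0.
  + by rewrite eO// ltn_neqAle ?ni ?nj.
- move=> k; rewrite ltnS leq_eqVlt => kn; rewrite big_ord_recr/= eqxx.
  under eq_bigr => i _ do rewrite (ltn_eqF (ltn_ord i)).
  by case/predU1P: kn => [->//|kn]; rewrite vw// scale0r addr0 -ev.
- move=> P P0 PD Pv.
  have Pe k : (k < n)%N -> P (e k).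
    by apply: eP => // j jn; apply: Pv; apply: ltnW.
  have PS (c : 'I_n -> R[i]) : P (\sum_(i < n) c i *: e i).
    by elim/big_rec : _ => // i x _ Px; apply: PD => //; apply: Pe.
  move=> k; rewrite ltnS leq_eqVlt; case: eqVneq => [_ _|_]; last exact: Pe.
  rewrite /w -[_ *: _]addr0; apply: (PD _ r 0) => //.
  rewrite /r addrC -scaleN1r; apply: (PD _ _ (v n)); first exact: PS.
  exact: Pv.
Qed.

(** The length of [e] is the cardinality of [I], whatever the dimension of the span; this later
    gives all frames the same size. *)
Lemma gram_schmidt (I : finType) (v : I -> H) : exists e : 'I_#|I| -> H,
  [/\ orthonormal0 e,
      forall i, v i = synth e (coefs e (v i))
    & forall P : H -> Prop, P 0 ->
        (forall a x y, P x -> P y -> P (a *: x + y)) ->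
        (forall i, P (v i)) -> forall k, P (e k)].
Proof.
have [e [eO ev eP]] := gram_schmidt_nat (nth 0 (codom v)) #|I|.
exists (fun i => e i); split => [i j|i|P P0 PD Pv k].
- by rewrite eO.
- have := ev (enum_rank i) (ltn_ord _); rewrite nth_codom enum_rankK => {1}->.
  by apply: eq_bigr => k _; rewrite ffunE.
- by apply: eP => // j jI; rewrite (nth_codom 0 v (Ordinal jI)).
Qed.

(** Bessel's inequality for one vector: the difference of the squares is the squared norm of
    [h - inner h e *: e]. *)
Lemma le_norm_inner (e h : H) : inner e e = (e != 0)%:R -> `|inner h e| <= `|h|.
Proof.
have [-> _|_ ee] := eqVneq e 0; first by rewrite linear0r normr0.
rewrite -(@ler_pXn2r _ 2) ?nnegrE// -subr_ge0.
have -> : `|h| ^+ 2 - `|inner h e| ^+ 2 = `|h - inner h e *: e| ^+ 2.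
  rewrite !normr_inner linearBl !linearBr !linearZl_LR !linearZr_LR/= ee mulr1.
  by rewrite (innerC e h) subrr subr0 normCK mulrC.
exact: exprn_ge0.
Qed.

Section frame.
Variables (n : nat) (e : 'I_n -> H).

Lemma coefs_linear : linear (coefs e).
Proof.
by move=> a x y; apply/ffunP => i; rewrite !ffunE linearDl linearZl_LR.
Qed.

(** Only an inequality, since coordinates at zero vectors of the family are lost. *)
Lemma norm_synth x : orthonormal0 e -> `|synth e x| <= `|x|.
Proof.
move=> eO; rewrite -(@ler_pXn2r _ 2) ?nnegrE// hsum_normE sqrtCK normr_inner.
rewrite linear_sumlz ler_sum// => i _; rewrite linearZl_LR/= linear_sumr.
rewrite (bigD1 i)//= big1 ?addr0 => [|j ji]; last first.
  by rewrite linearZr_LR/= eO eq_sym (negbTE ji) mulr0.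
rewrite linearZr_LR/= eO eqxx/= mulrA -normCK ler_piMr ?exprn_ge0//.
by case: (_ != _).
Qed.

(** Parseval: substituting the expansion into the second argument of [inner h h] gives the sum of
    the squared moduli of the coefficients. *)
Lemma norm_coefs h : h = synth e (coefs e h) -> `|coefs e h| = `|h|.
Proof.
move=> hE; rewrite hsum_normE -[RHS]sqrCK//; congr sqrtC.
rewrite normr_inner [in RHS]hE -[X in inner X _]hE linear_sumr; apply: eq_bigr => i _.
by rewrite ffunE linearZr_LR/= mulrC -normCK.
Qed.

Lemma orthonormal0_norm i : orthonormal0 e -> `|e i| <= 1.
Proof.
move=> eO; rewrite -(@ler_pXn2r _ 2) ?nnegrE ?ler01// expr1n normr_inner eO eqxx.
by case: (_ != _).
Qed.

End frame.
End gram_schmidt.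


(** * Complex matrices as operators *)

Section matrix_operators.
Variables (R : realType) (n : nat).
Implicit Types P Q : 'M[R[i]]_n.

Definition matop P (x : hsum n (complex_line R)) : hsum n (complex_line R) :=
  [ffun k => \sum_l P k l * (x l : R[i])].

Lemma bounded_matop P : bounded_op (matop P).
Proof.
split=> [a x y|].
  apply/ffunP => i; rewrite !ffunE scaler_sumr -big_split/=.
  by apply: eq_bigr => j _; rewrite !ffunE mulrDr mulrCA.
exists (\sum_i \sum_j `|P i j|) => x.
apply: le_trans (ler_hsum_norm _) _; rewrite mulr_suml ler_sum// => i _.
rewrite ffunE (le_trans (ler_norm_sum _ _ _))// mulr_suml ler_sum// => j _.
by rewrite [leLHS]normrM ler_wpM2l// ler_hsum_coord.
Qed.

Lemma matopD a P Q : matop (a *: P + Q) = a *: matop P + matop Q.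
Proof.
apply/funext => x; apply/ffunP => k; rewrite !ffunE scaler_sumr -big_split/=.
by apply: eq_bigr => l _; rewrite !mxE mulrDl -mulrA.
Qed.

Lemma matopM P Q : matop (P *m Q) = matop P \o matop Q.
Proof.
apply/funext => x; apply/ffunP => k; rewrite /= !ffunE.
under [RHS]eq_bigr => r _ do rewrite ffunE mulr_sumr.
rewrite exchange_big/=; apply: eq_bigr => l _; rewrite mxE mulr_suml.
by apply: eq_bigr => r _; rewrite mulrA.
Qed.

Lemma finite_dim_hsum : finite_dim [set: hsum n (complex_line R)].
Proof.
exists n, (fun k => [ffun l => (k == l)%:R : complex_line R] : hsum n (complex_line R)).
apply/seteqP; split => // x _ /=; exists x => //; apply/ffunP => k.
rewrite sum_ffunE (bigD1 k)//= big1 ?addr0 ?ffunE => [|l lk].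
  by rewrite eqxx; apply: mulr1.
by rewrite !ffunE (negbTE lk) scaler0.
Qed.

End matrix_operators.

(** * Compression to an invariant subspace *)

Section compression.
Variables (R : realType) (H : hilbertType R) (n : nat) (e : 'I_n -> H).

Definition compress (T : H -> H) : 'M[R[i]]_n :=
  \matrix_(k, l) inner (T (e l)) (e k).

Lemma compressD a S T : compress (a *: S + T) = a *: compress S + compress T.
Proof. by apply/matrixP => k l; rewrite !mxE linearDl linearZl_LR. Qed.

Lemma linear_synth (T : H -> H) x : linear T ->
  T (synth e x) = \sum_i (x i : R[i]) *: T (e i).
Proof.
move=> lT; rewrite linear_prop_sum//.
by apply: eq_bigr => i _; rewrite linear_propZ.
Qed.

Lemma matop_compress T x : linear T ->
  matop (compress T) x = coefs e (T (synth e x)).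
Proof.
move=> lT; apply/ffunP => k; rewrite !ffunE linear_synth// linear_sumlz.
by apply: eq_bigr => l _; rewrite mxE linearZl_LR mulrC.
Qed.

Definition frame_invariant (T : H -> H) :=
  forall k, T (e k) = synth e (coefs e (T (e k))).

(** [T (e l)] equals its own expansion in [e], so inserting that expansion between [S] and [T]
    changes nothing and yields the matrix product. *)
Lemma compress_comp S T : linear S -> frame_invariant T ->
  compress (S \o T) = compress S *m compress T.
Proof.
move=> lS iT; apply/matrixP => k l; rewrite !mxE /= iT linear_synth//.
rewrite linear_sumlz; apply: eq_bigr => r _.
by rewrite !mxE linearZl_LR/= ffunE mulrC.
Qed.

Definition range_synth : set H := [set h | h = synth e (coefs e h)].

Lemma range_synth0 : range_synth 0.
Proof.
rewrite /range_synth /= /synth big1// => i _.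
by rewrite ffunE linear0l scale0r.
Qed.

Lemma range_synthD a x y : range_synth x -> range_synth y ->
  range_synth (a *: x + y).
Proof.
rewrite /range_synth /= => {1}-> {1}->; rewrite /synth scaler_sumr -big_split/=.
by apply: eq_bigr => i _; rewrite coefs_linear !ffunE scalerDl scalerA.
Qed.

Lemma range_synth_sum (I : finType) (c : I -> R[i]) (x : I -> H) :
  (forall i, range_synth (x i)) -> range_synth (\sum_i c i *: x i).
Proof.
move=> rx; apply: (big_rec range_synth); first exact: range_synth0.
by move=> i y _; apply: range_synthD.
Qed.

Lemma range_synth_op T x : linear T -> frame_invariant T -> range_synth (T (synth e x)).
Proof. by move=> lT iT; rewrite linear_synth//; apply: range_synth_sum. Qed.

(** [matop (compress T)] is [T] between [synth] and [coefs]. By invariance the images under [T] stay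
    in [range_synth], where [coefs] preserves norms. *)
Lemma norm_mxop_compress m (X : 'M[H -> H]_m) x :
  (forall i j, linear (X i j)) -> (forall i j, frame_invariant (X i j)) ->
  `|mxop (map_mx (fun T => matop (compress T)) X) x| =
  `|mxop X [ffun j => synth e (x j)]|.
Proof.
move=> lX iX; rewrite !hsum_normE; congr sqrtC; apply: eq_bigr => i _.
congr (_ ^+ 2); rewrite !ffunE.
rewrite -[RHS](norm_coefs (e := e)); last first.
  apply: (big_rec range_synth) => [|j y _ ry]; first exact: range_synth0.
  rewrite -[X in X + _]scale1r ffunE.
  by apply: range_synthD => //; apply: range_synth_op.
rewrite (linear_prop_sum (coefs_linear e)).
by congr (`|_|); apply: eq_bigr => j _; rewrite mxE ffunE matop_compress.
Qed.

End compression.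

(** Orthonormalise the vectors [xi i] and [b l (xi i)]; the index [None] supplies [xi i] itself,
    since [A] may lack a unit. Their span is invariant because [A] is closed under composition and
    spanned by [b]. The size [d * (m + 1)] does not depend on [xi]. *)
Lemma exists_invariant_frame (R : realType) (H : hilbertType R) (A : set (H -> H))
    m (b : 'I_m -> H -> H) d (xi : hsum d H) :
  operator_algebra A -> A = [set \sum_i c i *: b i | c in [set: 'I_m -> R[i]]] ->
  exists e : 'I_#|{: 'I_d * option 'I_m}| -> H,
    [/\ orthonormal0 e, forall T, A T -> frame_invariant e T
      & forall i, xi i = synth e (coefs e (xi i))].
Proof.
move=> AA bA.
pose v (p : 'I_d * option 'I_m) :=
  if p.2 is Some l then b l (xi p.1) else xi p.1.
have [e [eO ev eP]] := gram_schmidt v; exists e; split => // [|i]; last first.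
  exact: (ev (i, None)).
have Ab l : A (b l).
  rewrite bA; exists (fun i => (i == l)%:R) => //.
  rewrite (bigD1 l)//= eqxx scale1r big1 ?addr0// => i il.
  by rewrite (negbTE il) scale0r.
have Axi T i : A T -> range_synth e (T (xi i)).
  rewrite bA => -[c _ <-]; rewrite fct_sumE.
  by apply: range_synth_sum => l; exact: (ev (i, Some l)).
(* Span induction: it suffices that [T] sends each generating vector into the span. *)
move=> T AT k; apply: (eP (fun x => range_synth e (T x))).
- rewrite (linear_prop0 (opalg_bounded AA AT).1); exact: range_synth0.
- by move=> a x y Px Py; rewrite (opalg_bounded AA AT).1; exact: range_synthD.
- move=> [i [l|]]; last exact: Axi.
  exact: (Axi (T \o b l) i (opalg_comp AA AT (Ab l))).
Qed.


(** * Passage to the limit in matrix operators *)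

Section ultralimits.
Variables (R : realType) (S : Type) (U : set_system S) (UU : UltraFilter U).

(** Each coordinate is a finite sum of products of convergent scalars. The vector may vary with [s]:
    a constant one serves for contractivity, the coordinates of the [xi s] for attaining the
    norm. *)
Lemma cvg_mxop_matop B m n (X : 'M[B]_m)
    (P : S -> B -> 'M[R[i]]_n) (Q : B -> 'M[R[i]]_n)
    (x : S -> hsum m (hsum n (complex_line R))) (y : hsum m (hsum n (complex_line R))) :
  (forall i j k l, (P s (X i j) k l : R[i]^o) @[s --> U] --> (Q (X i j) k l : R[i]^o)) ->
  (forall j l, (x s j l : R[i]^o) @[s --> U] --> (y j l : R[i]^o)) ->
  mxop (map_mx (fun b => matop (P s b)) X : 'M[_ -> _]_m) (x s) @[s --> U] -->
  (mxop (map_mx (fun b => matop (Q b)) X : 'M[_ -> _]_m) y : hsum m (hsum n (complex_line R))).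
Proof.
move=> PQ xy; apply: cvg_hsum => i; apply: cvg_hsum => k.
rewrite !ffunE sum_ffunE.
under eq_fun do rewrite !ffunE sum_ffunE.
apply: (cvg_sum_ord (V := R[i]^o)) => j; rewrite mxE ffunE.
under eq_fun do rewrite mxE ffunE.
by apply: (cvg_sum_ord (V := R[i]^o)) => l; apply: cvgM.
Qed.

End ultralimits.

(** * The ultralimit of the compressions *)

Theorem theorem3p5 (R : realType) (H : hilbertType R) (A : set (H -> H))
    (d : nat) (X : 'M[H -> H]_d) :
  operator_algebra A -> finite_dim A -> mx_over A X ->
  exists (F : hilbertType R) (pi : (H -> H) -> (F -> F)),
    [/\ finite_dim [set: F],
        opalg_hom A pi,
        completely_contractive A pi &
        opnorm (mxop (map_mx pi X)) = opnorm (mxop X)].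
Proof.
move=> AA [m [b bA]] AX.
have Ab T : A T -> bounded_op T by exact: (opalg_bounded AA).
have lA T : A T -> linear T by move=> /Ab[].
have bX : bounded_op (mxop X) by apply: bounded_mxop => i j; apply: Ab.
set K := opnorm (mxop X).
have [xi xiP] : {xi : nat -> hsum d H & forall s, `|xi s| <= 1 /\
    (K - s.+1%:R^-1)%:C <= `|mxop X (xi s)|}.
  apply: (choice (P := fun s x => `|x| <= 1 /\ (K - s.+1%:R^-1)%:C <= `|mxop X x|)) => s.
  have e0 : 0 < s.+1%:R^-1 :> R by rewrite invr_gt0.
  by have [x x1 xK] := opnorm_approx bX e0; exists x.
have [e eP] := choice (fun s => exists_invariant_frame (xi s) AA bA).
have eO s : orthonormal0 (e s) by case: (eP s).
have eI s T : A T -> frame_invariant (e s) T by case: (eP s) => _ + _; apply.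
have eX s i : xi s i = synth (e s) (coefs (e s) (xi s i)) by case: (eP s).
(* [U] contains all tails of the natural numbers, so the errors [s.+1%:R^-1] vanish along it. *)
have [U [UU oU]] := ultraFilterLemma eventually_filter.
(* For [T] in [A] these limits exist, as the entries are bounded by [opnorm T]; elsewhere [lim] may
   be a default value, and nothing is claimed there. *)
pose L T : 'M[R[i]]_#|{: 'I_d * option 'I_m}| :=
  \matrix_(k, l) lim ((compress (e s) T k l : R[i]^o) @[s --> U]).
have cL T : A T -> forall k l,
    (compress (e s) T k l : R[i]^o) @[s --> U] --> (L T k l : R[i]^o).
  move=> AT k l; rewrite mxE; apply: (@ultra_bounded_cvg _ _ _ _ _ (opnorm T)) => s.
  rewrite mxE (le_trans (le_norm_inner _ _)) ?eO ?eqxx//.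
  by apply: opnorm_ub; [exact: Ab|exact: orthonormal0_norm].
pose F := hsum #|{: 'I_d * option 'I_m}| (complex_line R).
exists F, (fun T => matop (L T)).
have limE (z : nat -> R[i]^o) (l : R[i]^o) : z @ U --> l -> lim (z @ U) = l.
  by apply: cvg_lim; exact: norm_hausdorff.
(* For fixed [x] each compression satisfies this bound, by [norm_mxop_compress] and [norm_synth],
   and it survives the limit. *)
have contr k (Y : 'M[H -> H]_k) x : mx_over A Y ->
    `|mxop (map_mx (fun T => matop (L T)) Y) x| <= (opnorm (mxop Y))%:C * `|x|.
  move=> AY; have bY : bounded_op (mxop Y) by apply: bounded_mxop => i j; apply: Ab.
  pose f s := mxop (map_mx (fun T => matop (compress (e s) T)) Y) x.
  apply: (@cvg_norm_le _ _ _ U _ f) => [|s].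
    by apply: cvg_mxop_matop => *; [apply: cL|apply: cvg_cst].
  rewrite norm_mxop_compress => [|i j|i j]; [|exact: lA|exact: eI].
  apply: le_trans (ler_opnorm _ bY) _; rewrite ler_wpM2l ?ler0c ?opnorm_ge0//.
  by apply: ler_hsum => i; rewrite ffunE; exact: norm_synth.
pose c : hsum d F :=
  [ffun i => [ffun k => lim ((inner (xi s i) (e s k) : R[i]^o) @[s --> U])]].
pose cs s : hsum d F := [ffun i => coefs (e s) (xi s i)].
have cs_cvg i k : (cs s i k : R[i]^o) @[s --> U] --> (c i k : R[i]^o).
  under eq_fun do rewrite !ffunE; rewrite !ffunE.
  apply: (@ultra_bounded_cvg _ _ _ _ _ 1) => s.
  apply: le_trans (le_norm_inner _ _) _; first by rewrite eO eqxx.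
  exact: le_trans (ler_hsum_coord _ _) (xiP s).1.
have csE s : `|cs s| <= 1.
  apply: le_trans (xiP s).1; apply: ler_hsum => i.
  by rewrite ffunE norm_coefs.
have c1 : `|c| <= 1.
  apply: (@cvg_norm_le _ _ _ U _ cs) => //.
  by apply: cvg_hsum => i; apply: cvg_hsum => k; apply: cs_cvg.
(* At stage [s] the coordinates [cs s] synthesise back to [xi s], so the norm of [f s] is that of
   [mxop X (xi s)]. *)
have cX : K%:C <= `|mxop (map_mx (fun T => matop (L T)) X) c|.
  pose f s := mxop (map_mx (fun T => matop (compress (e s) T)) X) (cs s).
  have fc : f @ U --> mxop (map_mx (fun T => matop (L T)) X) c.
    by apply: cvg_mxop_matop => // *; apply: cL.
  have fK s : (K - s.+1%:R^-1)%:C <= `|f s|.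
    rewrite norm_mxop_compress => [|i j|i j]; [|exact: lA|exact: eI].
    suff -> : [ffun j => synth (e s) (cs s j)] = xi s by exact: (xiP s).2.
    by apply/ffunP => i; rewrite !ffunE -eX.
  apply: (@cvg_norm_ge _ _ _ U _ f) => [|r r0]; first exact: fc.
  have q0 : 0 < complex.Re r by have := r0; rewrite (real_complex_of_ge0 (ltW r0)) ltcR.
  apply: oU; apply: filterS (near_infty_natSinv_lt (PosNum q0)) => s /= sr.
  apply: le_trans (fK s); rewrite rmorphB lerB//.
  by rewrite (real_complex_of_ge0 (ltW r0)) lecR ltW.
have cc : completely_contractive A (fun T => matop (L T)).
  move=> k Y AY; apply: opnorm_le => x x1.
  apply: le_trans (contr _ _ _ AY) _; rewrite ler_piMr// ler0c opnorm_ge0//.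
  by apply: bounded_mxop => i j; apply: Ab.
split.
- exact: finite_dim_hsum.
- split => [T _|a S T AS AT|S T AS AT].
  + exact: bounded_matop.
  + rewrite -matopD; congr matop; apply/matrixP => k l.
    have -> : (a *: L S + L T) k l = a * L S k l + L T k l by rewrite !mxE.
    rewrite [LHS]mxE; apply: limE.
    have cE s : compress (e s) (a *: S + T) k l =
        a * compress (e s) S k l + compress (e s) T k l.
      by rewrite compressD !mxE.
    under eq_fun do rewrite cE.
    by apply: cvgD; [apply: cvgM; [exact: cvg_cst|]|]; exact: cL.
  (* Invariance makes every compression multiplicative on [A]; the fixed matrix size makes the
     product a finite sum, which commutes with the limit. *)
  + rewrite -matopM; congr matop; apply/matrixP => k l.
    rewrite [LHS]mxE [RHS]mxE; apply: limE.
    under eq_fun do rewrite (compress_comp (lA _ AS) (eI _ _ AT)) mxE.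
    by apply: (cvg_sum_ord (V := R[i]^o)) => r; apply: cvgM; exact: cL.
- exact: cc.
- have bpi : bounded_op (mxop (map_mx (fun T => matop (L T)) X)).
    by apply: bounded_mxop => i j; rewrite mxE; exact: bounded_matop.
  apply/le_anti/andP; split; first exact: cc.
  (* The vector [c] of the unit ball witnesses the lower bound. *)
  by rewrite -lecR; apply: le_trans cX _; exact: opnorm_ub.
Qed.
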